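(* Let $K$ be a field of characteristic zero and $\mathbb{I}_1$ the algebra of polynomial integro-differential operators over $K$. Then: 1. ${}'\mathcal{C}_{\mathbb{I}_1}=\{\partial^{d(a)+i}a\mid i\in\mathbb{N},\ a\in\Gamma\}$. 2. $\mathcal{C}'_{\mathbb{I}_1}=({}'\mathcal{C}_{\mathbb{I}_1})^*$.
   Context: $\mathbb{N}=\{0,1,2,\ldots\}$. $\mathbb{I}_1$ is the subalgebra of $\mathrm{End}_K(K[x])$ generated by (multiplication by) $x$, $\partial=\frac{d}{dx}$ and $\int:K[x]\to K[x]$, $x^m\mapsto\frac{x^{m+1}}{m+1}$ ($m\geq0$). Put $H:=\partial x\in\mathbb{I}_1$ and $F:=\bigoplus_{i,j\in\mathbb{N}}Ke_{ij}$, where $e_{ij}=\int^i\partial^j-\int^{i+1}\partial^{j+1}$; $F$ is an ideal of $\mathbb{I}_1$. Each element $a\in\mathbb{I}_1$ is a unique finite sum $a=\sum_{i>0}a_{-i}\partial^i+a_0+\sum_{i>0}\int^ia_i+f$ with $a_k\in K[H]$ and $f\in F$. The algebra $\mathbb{I}_1$ is generated by $\partial,H,\int$ and admits the $K$-linear involution $*$ (an anti-isomorphism with $a^{**}=a$) determined by $\partial^*=\int$, $\int^*=\partial$, $H^*=H$. For a ring $R$, ${}'\mathcal{C}_R=\{r\in R\mid xr=0\Rightarrow x=0\}$ (left regular elements) and $\mathcal{C}'_R=\{r\in R\mid rx=0\Rightarrow x=0\}$ (right regular elements). $\Gamma:=\{a_0+\sum_{i\geq1}\int^ia_i+f\mid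 a_0\neq0,\text{ all }a_i\in K[H],\ f\in F\}$ (finite sums). For each $a\in\Gamma$ there is $i\geq0$ with $\partial^ia\in{}'\mathcal{C}_{\mathbb{I}_1}$, and the left regularity degree function $d:\Gamma\to\mathbb{N}$ is $d(a):=\min\{i\in\mathbb{N}\mid\partial^ia\in{}'\mathcal{C}_{\mathbb{I}_1}\}$. *)

(* Defs.v *)
From HB Require Import structures.
From mathcomp Require Import all_boot all_order all_algebra.
From mathcomp Require Import boolp classical_sets.
From mathcomp Require Import ring.

Set Implicit Arguments.
Unset Strict Implicit.
Unset Printing Implicit Defensive.

Import GRing.Theory.

Local Open Scope ring_scope.

(* Beware: left regular here amounts to GRing.rreg (right multiplication by r
   is injective), and right regular to GRing.lreg. *)

Definition left_regular_set (R : nzRingType) : set R :=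
  [set r | forall x : R, x * r = 0 -> x = 0]%classic.

Definition right_regular_set (R : nzRingType) : set R :=
  [set r | forall x : R, r * x = 0 -> x = 0]%classic.

Arguments left_regular_set : clear implicits.
Arguments right_regular_set : clear implicits.

(* End_K(K[x]), with composition as product; equality is decided classically. *)

Record endpoly (K : fieldType) := MkEndpoly {
  endpoly_fun :> {poly K} -> {poly K};
  endpoly_linear : linear endpoly_fun
}.

HB.instance Definition _ (K : fieldType) := gen_eqMixin (endpoly K).
HB.instance Definition _ (K : fieldType) := gen_choiceMixin (endpoly K).

HB.instance Definition _ (K : fieldType) (f : endpoly K) :=
  GRing.isLinear.Build K {poly K} {poly K} _ f (endpoly_linear f).

Section EndPoly.
Variable K : fieldType.
Implicit Types (f g h : endpoly K) (c : K).

Lemma endpolyP f g : f =1 g <-> f = g.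
Proof.
split=> [|-> //]; case: f g => [f fL] [g gL] /= /funext fg.
by case: g / fg gL => gL; congr MkEndpoly; apply: Prop_irrelevance.
Qed.

Fact endpoly_zero_linear : linear (fun _ : {poly K} => 0 : {poly K}).
Proof. by move=> c p q; rewrite scaler0 addr0. Qed.

Fact endpoly_opp_linear f : linear (fun p => - f p).
Proof. by move=> c p q; rewrite linearP opprD scalerN. Qed.

Fact endpoly_add_linear f g : linear (fun p => f p + g p).
Proof. by move=> c p q; rewrite !linearP scalerDr addrACA. Qed.

Fact endpoly_scale_linear c f : linear (fun p => c *: f p).
Proof. by move=> b p q; rewrite linearP scalerDr !scalerA mulrC. Qed.

Fact endpoly_one_linear : linear (fun p : {poly K} => p).
Proof. by []. Qed.

Fact endpoly_mul_linear f g : linear (fun p => f (g p)).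
Proof. by move=> c p q; rewrite !linearP. Qed.

Definition endpoly_zero : endpoly K := MkEndpoly endpoly_zero_linear.
Definition endpoly_opp f : endpoly K := MkEndpoly (endpoly_opp_linear f).
Definition endpoly_add f g : endpoly K := MkEndpoly (endpoly_add_linear f g).
Definition endpoly_scale c f : endpoly K := MkEndpoly (endpoly_scale_linear c f).
Definition endpoly_one : endpoly K := MkEndpoly endpoly_one_linear.
Definition endpoly_mul f g : endpoly K := MkEndpoly (endpoly_mul_linear f g).

Fact endpoly_addA : associative endpoly_add.
Proof. by move=> f g h; apply/endpolyP => p; rewrite /= addrA. Qed.
Fact endpoly_addC : commutative endpoly_add.
Proof. by move=> f g; apply/endpolyP => p; rewrite /= addrC. Qed.
Fact endpoly_add0 : left_id endpoly_zero endpoly_add.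
Proof. by move=> f; apply/endpolyP => p; rewrite /= add0r. Qed.
Fact endpoly_addN : left_inverse endpoly_zero endpoly_opp endpoly_add.
Proof. by move=> f; apply/endpolyP => p; rewrite /= addNr. Qed.

HB.instance Definition _ :=
  GRing.isZmodule.Build (endpoly K)
    endpoly_addA endpoly_addC endpoly_add0 endpoly_addN.

Fact endpoly_mulA : associative endpoly_mul.
Proof. by move=> f g h; apply/endpolyP. Qed.
Fact endpoly_mul1l : left_id endpoly_one endpoly_mul.
Proof. by move=> f; apply/endpolyP. Qed.
Fact endpoly_mul1r : right_id endpoly_one endpoly_mul.
Proof. by move=> f; apply/endpolyP. Qed.
Fact endpoly_mulDl : left_distributive endpoly_mul +%R.
Proof. by move=> f g h; apply/endpolyP. Qed.
Fact endpoly_mulDr : right_distributive endpoly_mul +%R.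
Proof. by move=> f g h; apply/endpolyP => p; rewrite /= linearD. Qed.
Fact endpoly_one_neq0 : endpoly_one != 0.
Proof.
by apply/eqP => /endpolyP /(_ 1); rewrite /= => /eqP; rewrite oner_eq0.
Qed.

HB.instance Definition _ :=
  GRing.Zmodule_isNzRing.Build (endpoly K)
    endpoly_mulA endpoly_mul1l endpoly_mul1r endpoly_mulDl endpoly_mulDr
    endpoly_one_neq0.

Fact endpoly_scaleA b c f :
  endpoly_scale b (endpoly_scale c f) = endpoly_scale (b * c) f.
Proof. by apply/endpolyP => p; rewrite /= scalerA. Qed.
Fact endpoly_scale1 : left_id 1 endpoly_scale.
Proof. by move=> f; apply/endpolyP => p; rewrite /= scale1r. Qed.
Fact endpoly_scaleDr : right_distributive endpoly_scale +%R.
Proof. by move=> c f g; apply/endpolyP => p; rewrite /= scalerDr. Qed.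
Fact endpoly_scaleDl f : {morph endpoly_scale^~ f : a b / a + b}.
Proof. by move=> a b; apply/endpolyP => p; rewrite /= scalerDl. Qed.

HB.instance Definition _ :=
  GRing.Zmodule_isLmodule.Build K (endpoly K)
    endpoly_scaleA endpoly_scale1 endpoly_scaleDr endpoly_scaleDl.

Fact endpoly_scaleAl c f g : c *: (f * g) = (c *: f) * g.
Proof. by apply/endpolyP. Qed.
HB.instance Definition _ :=
  GRing.Lmodule_isLalgebra.Build K (endpoly K) endpoly_scaleAl.

Fact endpoly_scaleAr c f g : c *: (f * g) = f * (c *: g).
Proof.
by apply/endpolyP => p; exact/esym/linearZ_LR.
Qed.
HB.instance Definition _ :=
  GRing.Lalgebra_isAlgebra.Build K (endpoly K) endpoly_scaleAr.

Lemma endpoly_funD f g p :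
  (f + g) p = f p + g p.
Proof. by []. Qed.
Lemma endpoly_funZ c f p : (c *: f) p = c *: f p.
Proof. by []. Qed.
Lemma endpoly_funM f g p :
  (f * g) p = f (g p).
Proof. by []. Qed.
Lemma endpoly_fun1 p : endpoly_fun 1 p = p.
Proof. by []. Qed.

Definition antideriv (p : {poly K}) : {poly K} :=
  \sum_(m < size p) (p`_m / m.+1%:R) *: 'X^(m.+1).

Lemma coef_antideriv p i :
  (antideriv p)`_i = if i is m.+1 then p`_m / m.+1%:R else 0.
Proof.
rewrite coef_sum; under eq_bigr do rewrite coefZ coefXn.
case: i => [|i]; first by rewrite big1 // => m _; rewrite mulr0.
under eq_bigr do rewrite eqSS.
have [ltip|leip] := ltnP i (size p).
  rewrite (bigD1 (Ordinal ltip)) //= eqxx mulr1 big1 ?addr0 // => m.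
  by rewrite -val_eqE /= eq_sym => /negPf ->; rewrite mulr0.
rewrite nth_default // mul0r big1 // => m _.
by rewrite gtn_eqF ?mulr0 // (leq_trans (ltn_ord m)).
Qed.

Fact antideriv_linear : linear antideriv.
Proof.
move=> c p q; apply/polyP => i; rewrite coefD coefZ !coef_antideriv.
case: i => [|i]; first by rewrite mulr0 addr0.
by rewrite coefD coefZ mulrDl mulrA.
Qed.

Lemma antiderivXn m : antideriv 'X^m = m.+1%:R^-1 *: 'X^(m.+1).
Proof.
apply/polyP => i; rewrite coef_antideriv coefZ coefXn.
case: i => [|i]; first by rewrite mulr0.
by rewrite coefXn eqSS mulrC; case: eqP => [->|]; rewrite ?mulr0.
Qed.

Fact mulX_linear : linear (fun p : {poly K} => 'X * p).
Proof. by move=> c p q; rewrite mulrDr scalerAr. Qed.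

Fact deriv_linear : linear (fun p : {poly K} => p^`()).
Proof. exact: linearP. Qed.

Definition end_x : endpoly K := MkEndpoly mulX_linear.
Definition end_d : endpoly K := MkEndpoly deriv_linear.
Definition end_int : endpoly K := MkEndpoly antideriv_linear.

(* The smallest subalgebra of End_K(K[x]) containing x, d/dx and the integral. *)
Definition I1_pred : {pred endpoly K} := [pred a | `[<
  forall S : {pred endpoly K}, GRing.subalg_closed S ->
    [/\ end_x \in S, end_d \in S & end_int \in S] -> a \in S >]].

Lemma I1_predP (a : endpoly K) :
  reflect (forall S : {pred endpoly K}, GRing.subalg_closed S ->
    [/\ end_x \in S, end_d \in S & end_int \in S] -> a \in S)
  (a \in I1_pred).
Proof. exact: asboolP. Qed.

Fact I1_subalg_closed : GRing.subalg_closed I1_pred.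
Proof.
split.
- by apply/I1_predP => S [].
- move=> c a b /I1_predP aI /I1_predP bI; apply/I1_predP => S Scl Sgen.
  by have [_ lin _] := Scl; apply: lin; [exact: aI|exact: bI].
- move=> a b /I1_predP aI /I1_predP bI; apply/I1_predP => S Scl Sgen.
  by have [_ _ mul] := Scl; apply: mul; [exact: aI|exact: bI].
Qed.

HB.instance Definition _ :=
  GRing.isSubalgClosed.Build K (endpoly K) I1_pred I1_subalg_closed.

Record I1 := MkI1 { I1val :> endpoly K; I1valP : I1val \in I1_pred }.

HB.instance Definition _ := [isSub for I1val].
HB.instance Definition _ := [Choice of I1 by <:].
HB.instance Definition _ := [SubChoice_isSubAlgebra of I1 by <:].

Fact end_x_I1 : end_x \in I1_pred.
Proof. by apply/I1_predP => S _ []. Qed.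
Fact end_d_I1 : end_d \in I1_pred.
Proof. by apply/I1_predP => S _ []. Qed.
Fact end_int_I1 : end_int \in I1_pred.
Proof. by apply/I1_predP => S _ []. Qed.

Definition I1x : I1 := MkI1 end_x_I1.
Definition I1d : I1 := MkI1 end_d_I1.
Definition I1int : I1 := MkI1 end_int_I1.
Definition I1H : I1 := I1d * I1x.

Definition e_ (i j : nat) : I1 :=
  I1int ^+ i * I1d ^+ j - I1int ^+ i.+1 * I1d ^+ j.+1.

Definition Fideal : set I1 := [set f | exists n (c : nat -> nat -> K),
  f = \sum_(i < n) \sum_(j < n) c i j *: e_ i j]%classic.

(* horner_alg I1H p is the element p(H) of K[H]. *)
Definition Gamma : set I1 :=
  [set a | exists n (p : nat -> {poly K}) (f : I1),
    [/\ horner_alg I1H (p 0%N) != 0, Fideal f &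
        a = horner_alg I1H (p 0%N)
            + \sum_(1 <= i < n) I1int ^+ i * horner_alg I1H (p i) + f]]%classic.

(* The least i such that I1d ^+ i * a is left regular (0 if there is none). *)
Definition ldeg (a : I1) : nat :=
  xget 0%N [set i | left_regular_set I1 (I1d ^+ i * a) /\
    forall j, left_regular_set I1 (I1d ^+ j * a) -> (i <= j)%N]%classic.

Definition is_involution (s : I1 -> I1) : Prop :=
  [/\ linear s, s 1 = 1, forall a b, s (a * b) = s b * s a & involutive s] /\
  [/\ s I1d = I1int, s I1int = I1d & s I1H = I1H].

(* The involution exists and is unique: it is matrix transposition in the
   basis 'X^j / j! of K[x]. *)

Section Involution.
Hypothesis charK : [pchar K] =i pred0.

Let natK n : (n.+1%:R : K) != 0.
Proof. by rewrite (pcharf0P _).1. Qed.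

Let factK n : (n`!%:R : K) != 0.
Proof. by rewrite (pcharf0P _).1 // -lt0n fact_gt0. Qed.

Definition end_entry (a : endpoly K) (i j : nat) : K :=
  i`!%:R / j`!%:R * (a 'X^j)`_i.

Lemma end_entryM (a b : endpoly K) i k n : (size (b 'X^k) <= n)%N ->
  end_entry (a * b) i k = \sum_(j < n) end_entry a i j * end_entry b j k.
Proof.
move=> bn; rewrite /end_entry endpoly_funM.
set q := b 'X^k in bn *.
have -> : q = \sum_(j < n) q`_j *: 'X^j.
  apply/polyP => m; rewrite coef_sum.
  under eq_bigr do rewrite coefZ coefXn.
  have [ltmn|lenm] := ltnP m n.
    rewrite (bigD1 (Ordinal ltmn)) //= eqxx mulr1 big1 ?addr0 // => j.
    by rewrite -val_eqE /= eq_sym => /negPf ->; rewrite mulr0.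
  rewrite nth_default ?(leq_trans bn) // big1 // => j _.
  by rewrite gtn_eqF ?mulr0 // (leq_trans (ltn_ord j)).
rewrite linear_sum coef_sum mulr_sumr; apply: eq_bigr => j _.
rewrite linearZ coefZ -/q.
have -> : (\sum_(j0 < n) q`_j0 *: 'X^j0)`_j = q`_j.
  rewrite coef_sum (bigD1 j) //= coefZ coefXn eqxx mulr1 big1 ?addr0 // => m.
  by rewrite -val_eqE /= eq_sym => mj; rewrite coefZ coefXn (negPf mj) mulr0.
rewrite [X in _ = X]mulrACA mulrA.
rewrite (_ : i`!%:R / j`!%:R * (j`!%:R / k`!%:R) = i`!%:R / k`!%:R); last first.
  by rewrite mulrA divfK.
by rewrite -[RHS]mulrA; congr (_ * _); exact: mulrC.
Qed.

Lemma end_entry_inj a b : end_entry a =2 end_entry b -> a = b.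
Proof.
move=> ab; apply/endpolyP => p.
have abX j : a 'X^j = b 'X^j.
  apply/polyP => i; apply: (@mulfI _ (i`!%:R / j`!%:R)).
    by rewrite mulf_neq0 ?invr_eq0.
  exact: ab.
rewrite -[p]coefK poly_def !linear_sum; apply: eq_bigr => j _.
by rewrite !linearZ /= abX.
Qed.

Definition is_transpose (a b : endpoly K) : Prop :=
  forall i j, end_entry a i j = end_entry b j i.

Lemma transpose_sym a b : is_transpose a b -> is_transpose b a.
Proof. by move=> ab i j; rewrite ab. Qed.

Lemma transpose_uniq a b b' : is_transpose a b -> is_transpose a b' -> b = b'.
Proof. by move=> ab ac; apply: end_entry_inj => i j; rewrite -ab -ac. Qed.

Lemma transpose_lin c (a a' b b' : endpoly K) : is_transpose a a' -> is_transpose b b' ->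
  is_transpose (c *: a + b) (c *: a' + b').
Proof.
move=> aa bb i j; move: (aa i j) (bb i j); rewrite /end_entry.
rewrite !endpoly_funD !endpoly_funZ !coefD !coefZ => aij bij.
rewrite 2!mulrDr bij; congr (_ + _).
by rewrite mulrCA aij mulrCA.
Qed.

Lemma transpose_mul a a' b b' : is_transpose a a' -> is_transpose b b' ->
  is_transpose (a * b) (b' * a').
Proof.
move=> aa bb i j.
pose n := maxn (size (b 'X^j)) (size (a' 'X^i)).
rewrite (@end_entryM _ _ _ _ n) ?leq_maxl //.
rewrite (@end_entryM _ _ _ _ n) ?leq_maxr //.
by apply: eq_bigr => k _; rewrite aa bb mulrC.
Qed.

Lemma transpose1 : is_transpose 1 1.
Proof.
move=> i j; rewrite /end_entry !endpoly_fun1 !coefXn eq_sym.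
by case: eqP => [->|]; rewrite ?mulr0.
Qed.

Lemma transpose_d : is_transpose end_d end_int.
Proof.
move=> i j; rewrite /end_entry /= coef_deriv antiderivXn coefZ !coefXn.
rewrite eq_sym; case: eqP => [->|_]; last by rewrite mul0rn !mulr0.
by rewrite !factS !natrM; field; rewrite nat1r natK factK.
Qed.

Lemma transpose_x : is_transpose end_x (end_d * end_x * end_d).
Proof.
move=> i j; rewrite /end_entry /= coef_deriv !coefXM /=.
rewrite coef_deriv !coefXn; case: i => [|i].
  by rewrite mulr0 !mul0rn mulr0.
rewrite eqSS /= eq_sym; case: eqP => [->|_]; last by rewrite !mul0rn !mulr0.
rewrite factS -2!mulrnA mul1n !natrM mulr1.
move: (i.+1%:R) (i`!%:R : K) (natK i) (factK i) => u v u0 v0.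
by field; rewrite u0 v0.
Qed.

Lemma transpose_I1 (a : I1) : exists b : I1, is_transpose a b.
Proof.
pose S := [pred f : endpoly K | `[< exists b : I1, is_transpose f b >]].
suff /asboolP : I1val a \in S by [].
apply: (I1_predP _ (I1valP a)); split.
- by apply/asboolP; exists 1; exact: transpose1.
- move=> c f g /asboolP[f' ff'] /asboolP[g' gg']; apply/asboolP.
  by exists (c *: f' + g'); exact: transpose_lin.
- move=> f g /asboolP[f' ff'] /asboolP[g' gg']; apply/asboolP.
  by exists (g' * f'); exact: transpose_mul.
- by apply/asboolP; exists (I1d * I1x * I1d); exact: transpose_x.
- by apply/asboolP; exists I1int; exact: transpose_d.
- by apply/asboolP; exists I1d; apply: transpose_sym; exact: transpose_d.
Qed.

Lemma end_d_int : end_d * end_int = 1.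
Proof.
apply/endpolyP => p; apply/polyP => i.
by rewrite /= coef_deriv coef_antideriv -[LHS]mulr_natr divfK.
Qed.

Lemma transpose_H : is_transpose I1H I1H.
Proof.
suff {2}-> : I1val I1H = (end_d * end_x * end_d) * end_int.
  exact: transpose_mul transpose_d transpose_x.
by rewrite -[RHS]mulrA end_d_int mulr1.
Qed.

Lemma involution_exists : exists s : I1 -> I1, is_involution s.
Proof.
have [s sP] := choice transpose_I1.
have sE a b : is_transpose (I1val a) (I1val b) -> s a = b.
  by move=> ab; apply: val_inj; exact: transpose_uniq (sP a) ab.
exists s; split; split.
- by move=> c a b; apply: sE; exact: transpose_lin.
- by apply: sE; exact: transpose1.
- by move=> a b; apply: sE; exact: transpose_mul.
- by move=> a; apply: sE; exact: transpose_sym.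
- by apply: sE; exact: transpose_d.
- by apply: sE; apply: transpose_sym; exact: transpose_d.
- by apply: sE; exact: transpose_H.
Qed.

Lemma I1_x_eq : I1x = I1int * I1H.
Proof.
apply: val_inj; apply/endpolyP => p; apply/polyP => i.
rewrite /= coef_antideriv coefXM; case: i => [|i] //=.
by rewrite coef_deriv coefXM /= -[X in X / _]mulr_natr mulfK.
Qed.

Lemma involution_uniq (s t : I1 -> I1) :
  is_involution s -> is_involution t -> s =1 t.
Proof.
case=> -[sL s1 sM _] [sd si sH] [[tL t1 tM _] [td ti tH]] a.
pose S := [pred f : endpoly K | `[< exists b : I1, I1val b = f /\ s b = t b >]].
suff /asboolP[b [/val_inj -> //]] : I1val a \in S.
apply: (I1_predP _ (I1valP a)); split.
- by apply/asboolP; exists 1; split=> //; rewrite s1 t1.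
- move=> c f g /asboolP[f' [<- ff']] /asboolP[g' [<- gg']]; apply/asboolP.
  by exists (c *: f' + g'); split=> //; rewrite sL tL ff' gg'.
- move=> f g /asboolP[f' [<- ff']] /asboolP[g' [<- gg']]; apply/asboolP.
  by exists (f' * g'); split=> //; rewrite sM tM ff' gg'.
- by apply/asboolP; exists I1x; split=> //; rewrite I1_x_eq sM tM si ti sH tH.
- by apply/asboolP; exists I1d; split=> //; rewrite sd td.
- by apply/asboolP; exists I1int; split=> //; rewrite si ti.
Qed.

Definition star : I1 -> I1 := projT1 (cid involution_exists).

Lemma starP : is_involution star.
Proof. exact: projT2 (cid involution_exists). Qed.

End Involution.
End EndPoly.

Arguments Fideal : clear implicits.
Arguments Gamma : clear implicits.

(* Main.v *)
From HB Require Import structures.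
Require Import Defs.
From mathcomp Require Import all_boot all_order all_algebra.
From mathcomp Require Import boolp classical_sets.

Set Implicit Arguments.
Unset Strict Implicit.
Unset Printing Implicit Defensive.

Import GRing.Theory.

Local Open Scope ring_scope.

(** Write J for integration, D for derivation, and e for [e_ 0 0] = 1 - J D, the
projection of K[x] onto the constants.

Since D J = 1, the powers of D occurring in a given operator r can be cancelled
from the right: r J^n is, for n large, a sum of terms J^i p_i(H) with i >= 0
([I1_eventually_lower]).  The factor J^n loses little information: the operators
killed by some J^n on the right are exactly those of F ([FidealP]).  Hence Gamma
consists of the operators a for which a J^n = (sum_i J^i p_i(H)) J^n for some n,
with p_0 nonzero ([GammaP]).

Let r J^n = J^k (sum_i J^i q_i(H)) with q_0 nonzero.  If k <= n, moving J^n across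
the sum to the right shows that a = J^(n-k) r lies in Gamma, and r = D^(n-k) a.  If
k > n, or if r J^n = 0, then r shifts the basis x^j/j! strictly upwards from j = n
on, so that only n columns of its matrix meet the first n+1 rows.  These rows are
then linearly dependent, and their relation is an element of F killing r on the
left ([not_left_regular]).  Thus every left regular element is some D^m a with a in
Gamma, and m >= d(a) by minimality of d(a).

Conversely, let a be in Gamma.  For n large, D^n a J^n is a sum of terms J^i q_i(H)
where q_0 has no root among the positive integers.  Its image under the involution
is the sum of the q_i(H) D^i; it multiplies the leading coefficient of a polynomial
of degree m by q_0(m+1), hence is injective, and so D^n a is left regular
([lower_left_regular], [Gamma_left_regular]).  Multiplying a left regular element by
D on the left keeps it left regular, as D has a right inverse.

The second part holds for any involution, which exchanges the two notions of
regularity. *)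

(** * Generalities on rings and polynomials *)

Lemma horner_alg_intertwine (R : comNzRingType) (A : algType R) (a b c : A)
    (p : {poly R}) :
  a * c = c * b -> horner_alg a p * c = c * horner_alg b p.
Proof.
move=> ac; elim/poly_ind: p => [|p k IHp]; first by rewrite !rmorph0 mulr0 mul0r.
rewrite !rmorphD !rmorphM /= !horner_algX !horner_algC mulrDl mulrDr.
by rewrite -mulrA ac mulrA IHp mulrA -scalerAl -scalerAr mul1r mulr1.
Qed.

Lemma horner_alg_comp (R : comNzRingType) (A : algType R) (a : A) (p q : {poly R}) :
  horner_alg a (p \Po q) = horner_alg (horner_alg a q) p.
Proof.
elim/poly_ind: p => [|p k IHp]; first by rewrite comp_poly0 !rmorph0.
rewrite comp_polyD comp_polyM comp_polyX comp_polyC.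
by rewrite !rmorphD !rmorphM /= !horner_algC !horner_algX IHp.
Qed.

Lemma poly_factorXn (R : nzRingType) (P : {poly R}) :
  P != 0 -> exists k (Q : {poly R}), P = 'X^k * Q /\ Q`_0 != 0.
Proof.
elim/poly_ind: P => [|P c IHP]; first by rewrite eqxx.
have [-> | c0 _] := eqVneq c 0.
  rewrite addr0 => PX; have /IHP[k [Q [-> Q0]]] : P != 0.
    by apply: contraNneq PX => ->; rewrite mul0r.
  by exists k.+1, Q; rewrite exprSr -mulrA commr_polyX mulrA commr_polyX.
by exists 0%N, (P * 'X + c%:P); rewrite mul1r coefD coefMX coefC add0r.
Qed.

Lemma left_regular_mul (R : nzRingType) (a b : R) :
  left_regular_set R a -> left_regular_set R b ->
  left_regular_set R (a * b).
Proof. by move=> ra rb y; rewrite mulrA => /rb/ra. Qed.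

(** Each natural root k can be divided out as a factor X - k; in characteristic zero
such a factor vanishes at no other natural. *)
Lemma poly_nonroot_large (K : fieldType) (charK : [pchar K] =i pred0)
    (p : {poly K}) : p != 0 ->
  exists N, forall n, (N <= n)%N -> p.[n%:R] != 0.
Proof.
have [m] := ubnP (size p); elim: m p => // m IHm p /ltnSE-pm p0.
have [[k /eqP pk]|noroot] := pselect (exists k : nat, p.[k%:R] == 0); last first.
  by exists 0%N => n _; apply/negP => pn; apply: noroot; exists n.
have /factor_theorem[q pE] : root p k%:R by apply/eqP.
have q0 : q != 0 by apply: contraNneq p0 => q0; rewrite pE q0 mul0r.
have [|N qN] := IHm q _ q0.
  by rewrite pE size_Mmonic ?monicXsubC // size_XsubC addn2 /= in pm.
exists (maxn N k.+1) => n; rewrite geq_max => /andP[Nn kn].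
rewrite pE hornerM hornerXsubC mulf_neq0 ?qN // subr_eq0 -subr_eq0.
by rewrite -natrB 1?ltnW // (pcharf0P _).1 // subn_eq0 -ltnNge.
Qed.

(** * Relations between derivation, integration and H *)

Section IntegroDifferential.

Variable K : fieldType.
Hypothesis charK : [pchar K] =i pred0.

Implicit Types (p : {poly K}) (P Q : {poly {poly K}}) (a b f r y : I1 K).

Local Notation D := (I1d K).
Local Notation J := (I1int K).
Local Notation H := (I1H K).
Local Notation e := (e_ K 0 0).

Lemma I1P a b : (forall p, a p = b p) -> a = b.
Proof. by move=> ab; apply/val_inj/endpolyP. Qed.

Lemma DJ : D * J = 1.
Proof. by apply: val_inj; exact: end_d_int. Qed.

Lemma DJexp n : D ^+ n * J ^+ n = 1.
Proof.
elim: n => [|n IHn]; first by rewrite mulr1.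
by rewrite exprSr exprS mulrA -(mulrA _ D) DJ mulr1.
Qed.

Lemma DJexp_sub m n : (m <= n)%N -> D ^+ m * J ^+ n = J ^+ (n - m).
Proof. by move=> mn; rewrite -{1}(subnKC mn) exprD mulrA DJexp mul1r. Qed.

Lemma e00E : e = 1 - J * D.
Proof. by rewrite /e_ !expr0 mulr1 !expr1. Qed.

Lemma eJ : e * J = 0.
Proof. by rewrite e00E mulrBl -mulrA DJ mulr1 mul1r subrr. Qed.

Lemma e_E i j : e_ K i j = J ^+ i * e * D ^+ j.
Proof. by rewrite e00E mulrBr mulr1 mulrBl /e_ exprSr exprS !mulrA. Qed.

(** This is the Leibniz rule D x = x D + 1 multiplied by J on the right, as x = J H. *)
Lemma HJ : H * J = J * (H + 1).
Proof.
have xJ : I1x K = J * H := I1_x_eq charK.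
have comm : D * I1x K = I1x K * D + 1.
  by apply: I1P => p; rewrite /= derivM derivX mul1r addrC.
rewrite mulrDr -xJ mulr1 /I1H comm mulrDl -mulrA DJ mulr1 mul1r //.
Qed.

Lemma HJexp n : H * J ^+ n = J ^+ n * (H + n%:R).
Proof.
elim: n => [|n IHn]; first by rewrite mulr1 mul1r addr0.
rewrite exprSr mulrA IHn -!mulrA; congr (_ * _).
by rewrite mulrDl HJ mulr_natl -mulr_natr -mulrDr -addrA nat1r.
Qed.

Lemma e00_fun p : e p = (p`_0)%:P.
Proof.
rewrite e00E; apply/polyP => i.
rewrite /= coefB coef_antideriv coefC; case: i => [|i] /=; first by rewrite subr0.
rewrite coef_deriv -[p`_i.+1 *+ i.+1]mulr_natr mulfK ?subrr //.
by rewrite (pcharf0P _).1.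
Qed.

Lemma Dexp_fun n p : (D ^+ n) p = p^`(n).
Proof. by elim: n => //= n <-; rewrite exprS. Qed.

Lemma I1_sum_fun n (F : 'I_n -> I1 K) p : (\sum_i F i) p = \sum_i F i p.
Proof. by elim/big_rec2: _ => //= i u v _ <-. Qed.

(** * The corner element and the finite-rank part *)

Definition const_term a : K := (a 1)`_0.

Lemma I1_funC a (c : K) : a c%:P = c *: a 1.
Proof. by rewrite -alg_polyC linearZ. Qed.

(** The image of e is the line of constants, so the corner ring e I_1 e is K. *)
Lemma e00_corner a : e * a * e = const_term a *: e.
Proof.
apply: I1P => p.
have -> : (e * a * e) p = e (a (e p)) by [].
have -> : (const_term a *: e) p = const_term a *: e p by [].
by rewrite e00_fun (e00_fun p) I1_funC coefZ -mul_polyC -polyCM mulrC.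
Qed.

(** The Taylor expansion at 0 of order n, with integral remainder J^n D^n. *)
Lemma resolution n : 1 = J ^+ n * D ^+ n + \sum_(j < n) e_ K j j.
Proof.
elim: n => [|n IHn]; first by rewrite big_ord0 addr0 mulr1.
by rewrite big_ord_recr /= /e_ [RHS]addrCA [X in _ = _ + X]addrC subrK addrC.
Qed.

Lemma e00D_J m n : (m < n)%N -> e * D ^+ m * J ^+ n = 0.
Proof.
move=> mn; rewrite -mulrA DJexp_sub 1?ltnW // -(prednK (n := n - m)) ?subn_gt0 //.
by rewrite exprS mulrA eJ mul0r.
Qed.

Lemma De00 : D * e = 0.
Proof. by rewrite e00E mulrBr mulrA DJ mulr1 mul1r subrr. Qed.

Lemma e00_idem : e * e = e.
Proof. by rewrite [X in _ * X]e00E mulrBr mulrA eJ mul0r mulr1 subr0. Qed.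

Lemma e00_neq0 : e != 0.
Proof.
apply: contra_neq (oner_neq0 {poly K}) => e0.
by have := e00_fun 1; rewrite e0 coef1 => /esym.
Qed.

(** The column a e lies in F because a 1 is a polynomial: all its Taylor coefficients
of order at least n vanish. *)
Lemma mul_e00 a n : (size (a 1%R) <= n)%N ->
  a * e = \sum_(i < n) const_term (D ^+ i * a) *: (J ^+ i * e).
Proof.
move=> an; rewrite -[LHS]mul1r (resolution n) mulrDl -[X in X + _]mulrA.
rewrite (_ : D ^+ n * (a * e) = 0) ?mulr0 ?add0r; last first.
  apply: I1P => p.
  have -> : (D ^+ n * (a * e)) p = (D ^+ n) (a (e p)) by [].
  by rewrite e00_fun I1_funC Dexp_fun derivnZ derivn_poly0 ?scaler0.
rewrite mulr_suml; apply: eq_bigr => i _.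
rewrite scalerAr -e00_corner e_E.
by rewrite !mulrA.
Qed.

(** Only finitely many columns of f are nonzero if f J^n = 0, and each column is
finite because the values of f are polynomials. *)
Lemma FidealP f : Fideal K f <-> exists n, f * J ^+ n = 0.
Proof.
split=> [[n [c ->]]|[N fN]].
  exists n; rewrite mulr_suml big1 // => i _; rewrite mulr_suml big1 // => j _.
  by rewrite -scalerAl e_E -!mulrA (mulrA e) e00D_J // mulr0 scaler0.
pose n := maxn N (\max_(j < N) size ((f * J ^+ j)%R 1%R)).
have fn : f * J ^+ n = 0.
  by rewrite -(subnKC (leq_maxl N _ : (N <= n)%N)) exprD mulrA fN mul0r.
have size_n (j : nat) : (size ((f * J ^+ j)%R 1%R) <= n)%N.
  have [jN|Nj] := ltnP j N.
    by rewrite leq_max (leq_bigmax (Ordinal jN)) orbT.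
  by rewrite -(subnKC Nj) exprD mulrA fN mul0r size_poly0.
exists n, (fun i j => const_term (D ^+ i * (f * J ^+ j))).
transitivity (\sum_(j < n) \sum_(i < n)
    const_term (D ^+ i * (f * J ^+ j)) *: e_ K i j); last exact: exchange_big.
rewrite -[LHS]mulr1 (resolution n) mulrDr mulrA fn mul0r add0r mulr_sumr.
apply: eq_bigr => j _.
rewrite e_E 2!(mulrA f) (mul_e00 (size_n j)) mulr_suml; apply: eq_bigr => i _.
by rewrite (e_E i) -scalerAl.
Qed.

(** * Operators without derivation terms *)

(** The operator sum_i J^i P_i(H), whose matrix in the basis x^j/j! is lower
triangular.  Packing the coefficients P_i into a polynomial over K[H] turns left
multiplication by J^k into multiplication by 'X^k. *)
Definition lower P : I1 K :=
  \sum_(i < size P) J ^+ i * horner_alg H P`_i.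

Lemma lowerE n P : (size P <= n)%N ->
  lower P = \sum_(i < n) J ^+ i * horner_alg H P`_i.
Proof.
move=> sP; rewrite /lower.
rewrite (big_ord_widen n (fun i => J ^+ i * horner_alg H P`_i) sP) big_mkcond.
apply: eq_bigr => i _; case: ltnP => // Pi.
by rewrite nth_default // rmorph0 mulr0.
Qed.

Lemma lower0 : lower 0 = 0.
Proof. by rewrite /lower size_poly0 big_ord0. Qed.

Lemma lowerD P Q : lower (P + Q) = lower P + lower Q.
Proof.
pose n := maxn (size P) (size Q).
rewrite (@lowerE n (P + Q)) ?size_polyD // (@lowerE n P) ?leq_maxl //.
rewrite (@lowerE n Q) ?leq_maxr // -big_split; apply: eq_bigr => i _.
by rewrite coefD rmorphD mulrDr.
Qed.

Lemma lowerZ (c : K) P : lower (c%:P *: P) = c *: lower P.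
Proof.
rewrite (@lowerE (size P)) ?size_scale_leq // /lower scaler_sumr.
apply: eq_bigr => i _; rewrite coefZ rmorphM /= horner_algC.
by rewrite mulr_algl scalerAr.
Qed.

Lemma lowerC p : lower p%:P = horner_alg H p.
Proof. by rewrite (@lowerE 1) ?size_polyC_leq1 // big_ord1 coefC mul1r. Qed.

Lemma lowerXn k P : lower ('X^k * P) = J ^+ k * lower P.
Proof.
elim: k => [|k IHk]; first by rewrite !mul1r.
rewrite !exprS -!mulrA -{}IHk; move: ('X^k * P) => {}P.
rewrite (@lowerE (size P).+1) ?(leq_trans (size_polyMleq _ _)) ?size_polyX //.
rewrite big_ord_recl coefXM rmorph0 mulr0 add0r /lower mulr_sumr.
by apply: eq_bigr => i _; rewrite coefXM /= exprS mulrA.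
Qed.

(** Substitution of H + n, resp. H - n, for H in every coefficient of [lower P]. *)
Definition shift n P := map_poly (comp_poly ('X + n%:R)) P.
Definition unshift n P := map_poly (comp_poly ('X - n%:R)) P.

(** The basis vector x^j/j! is an eigenvector of H, and J^n raises its eigenvalue by n. *)
Lemma horner_algJ n p :
  horner_alg H p * J ^+ n = J ^+ n * horner_alg H (p \Po ('X + n%:R)).
Proof.
rewrite horner_alg_comp; apply: horner_alg_intertwine.
by rewrite HJexp rmorphD /= horner_algX rmorph_nat.
Qed.

Lemma lowerJ n P : lower P * J ^+ n = J ^+ n * lower (shift n P).
Proof.
rewrite (@lowerE (size P) (shift n P)) ?size_poly //.
rewrite /lower mulr_suml mulr_sumr; apply: eq_bigr => i _.
by rewrite -mulrA horner_algJ coef_map !mulrA -!exprD addnC.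
Qed.

Lemma unshiftK n P : shift n (unshift n P) = P.
Proof.
apply/polyP => i; rewrite !coef_map /= -comp_polyA.
by rewrite comp_polyB comp_polyX -polyC_natr comp_polyC addrK comp_polyXr.
Qed.

(** * Cancelling derivation terms by integration *)

Definition eventually_lower a := exists n P, a * J ^+ n = lower P.

Lemma eventually_lower_le a m n P : a * J ^+ m = lower P -> (m <= n)%N ->
  a * J ^+ n = lower ('X^(n - m) * shift (n - m) P).
Proof. by move=> aP mn; rewrite -{1}(subnKC mn) exprD mulrA aP lowerXn lowerJ. Qed.

Lemma eventually_lower_lin (c : K) a b :
  eventually_lower a -> eventually_lower b -> eventually_lower (c *: a + b).
Proof.
case=> m [P aP] [n [Q bQ]]; exists (maxn m n).
have aP' := eventually_lower_le aP (leq_maxl m n).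
have bQ' := eventually_lower_le bQ (leq_maxr m n).
by eexists; rewrite mulrDl -scalerAl aP' bQ' -lowerZ -lowerD.
Qed.

(** It suffices that the class of eventually lower operators is stable under right
multiplication by each generator.  For D this is (y D) J^(n+1) = y J^n; for J and H
one moves J^n to the left with [horner_algJ]. *)
Lemma I1_eventually_lower a : eventually_lower a.
Proof.
have good1 : eventually_lower 1.
  by exists 0%N, 1%:P; rewrite lowerC rmorph1 mulr1.
(* The stabilizer, under right multiplication, of the linear class is a subalgebra. *)
pose S := [pred u : endpoly K | `[< exists b, I1val b = u /\
  forall y, eventually_lower y -> eventually_lower (y * b) >]].
have J_S y : eventually_lower y -> eventually_lower (y * J).
  case=> n [P yP]; exists n, ('X^1 * shift 1 P).
  by rewrite lowerXn -lowerJ -yP -!mulrA -exprS -exprSr.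
have H_S y : eventually_lower y -> eventually_lower (y * H).
  case=> n [P yP]; exists n, (('X + n%:R)%:P * P).
  rewrite -mulrA HJexp mulrA yP (@lowerE (size P) (_ * P)); last first.
    by rewrite mul_polyC size_scale_leq.
  rewrite /lower mulr_suml; apply: eq_bigr => i _.
  by rewrite coefCM mulrC rmorphM rmorphD /= horner_algX rmorph_nat mulrA.
suff /asboolP[b [/val_inj <- /(_ 1 good1)]] : I1val a \in S by rewrite mul1r.
apply: (I1_predP _ (I1valP a)); split.
- by apply/asboolP; exists 1; split=> // y; rewrite mulr1.
- move=> c u v /asboolP[b [<- bS]] /asboolP[b' [<- bS']]; apply/asboolP.
  exists (c *: b + b'); split=> // y yS; rewrite mulrDr -scalerAr.
  by apply: eventually_lower_lin; [exact: bS|exact: bS'].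
- move=> u v /asboolP[b [<- bS]] /asboolP[b' [<- bS']]; apply/asboolP.
  by exists (b * b'); split=> // y yS; rewrite mulrA; apply/bS'/bS.
- apply/asboolP; exists (I1x K); split=> // y yS.
  by rewrite (I1_x_eq charK) mulrA; apply/H_S/J_S.
- apply/asboolP; exists D; split=> // y [n [P yP]]; exists n.+1, P.
  by rewrite exprS mulrA -(mulrA y) DJ mulr1.
- by apply/asboolP; exists J; split=> // y; exact: J_S.
Qed.

(** * An obstruction to left regularity *)

(** The first n+1 rows of the matrix of r vanish outside its first n columns, hence are
linearly dependent; the row f encoding the relation satisfies f r = 0. *)
Lemma not_left_regular r n b :
  r * J ^+ n = J ^+ n.+1 * b -> ~ left_regular_set (I1 K) r.
Proof.
move=> rn reg_r.
(* The entries of r in the basis x^j/j!, in rows 0 to n and columns 0 to n - 1. *)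
pose A : 'M[K]_(n.+1, n) := \matrix_(k, j) const_term (D ^+ k * (r * J ^+ j)).
have /rowV0Pn[u /sub_kermxP uA u0] : kermx A != 0.
  by rewrite -mxrank_eq0 mxrank_ker subn_eq0 -ltnNge ltnS rank_leq_col.
pose f := \sum_k u 0 k *: (e * D ^+ k).
have frJ : f * r * J ^+ n = 0.
  rewrite -mulrA rn /f mulr_suml big1 // => k _.
  by rewrite -scalerAl mulrA e00D_J // mul0r scaler0.
have fr0 : f * r = 0.
  rewrite -[LHS]mulr1 (resolution n) mulrDr mulrA frJ mul0r add0r.
  rewrite mulr_sumr big1 // => j _.
  rewrite e_E 2!mulrA -(mulrA f).
  suff -> : f * (r * J ^+ j) * e = 0 by rewrite mul0r.
  transitivity ((u *m A) 0 j *: e); last by rewrite uA mxE scale0r.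
  rewrite mxE scaler_suml /f !mulr_suml; apply: eq_bigr => k _.
  by rewrite mxE -!scalerAl -(mulrA e) e00_corner scalerA.
have f0 := reg_r f fr0.
case/negP: u0; apply/eqP/rowP => k; rewrite mxE.
(* The coefficient of e D^k in f is recovered as f J^k e. *)
have : u 0 k *: e = 0; last first.
  by move/eqP; rewrite scaler_eq0 (negPf e00_neq0) orbF => /eqP.
rewrite -(mul0r (J ^+ k * e)) -f0 /f mulr_suml (bigD1 k) //= big1 ?addr0 => [|j jk].
  by rewrite -scalerAl -mulrA (mulrA (D ^+ k)) DJexp mul1r e00_idem.
rewrite -scalerAl mulrA; case: (ltngtP j k) => [lt_jk|lt_kj|/val_inj eq_jk].
- by rewrite e00D_J // mul0r scaler0.
- rewrite -(subnK lt_kj) addnS -addSn exprD exprSr.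
  by rewrite -!mulrA (mulrA (D ^+ k)) DJexp mul1r De00 !mulr0 scaler0.
- by rewrite eq_jk eqxx in jk.
Qed.

(** * Left regularity through the involution *)

Lemma star_linear : linear (star charK).
Proof. by have [[]] := starP charK. Qed.

HB.instance Definition _ :=
  GRing.isLinear.Build K (I1 K) (I1 K) _ (star charK) star_linear.

Lemma star1 : star charK 1 = 1.
Proof. by have [[]] := starP charK. Qed.

Lemma starM a b : star charK (a * b) = star charK b * star charK a.
Proof. by have [[]] := starP charK. Qed.

Lemma starK : involutive (star charK).
Proof. by have [[]] := starP charK. Qed.

Lemma starJexp n : star charK (J ^+ n) = D ^+ n.
Proof.
have [_ [_ sJ _]] := starP charK.
by elim: n => [|n IHn]; rewrite ?star1 // exprSr starM IHn sJ exprS.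
Qed.

Lemma star_horner p : star charK (horner_alg H p) = horner_alg H p.
Proof.
have [_ [_ _ sH]] := starP charK.
elim/poly_ind: p => [|p c IHp]; first by rewrite !rmorph0 linear0.
rewrite rmorphD rmorphM /= horner_algX horner_algC linearD linearZ /= star1.
rewrite starM sH IHp; congr (_ + _).
by rewrite -[X in X * _ = _](horner_algX H) -rmorphM mulrC rmorphM /= horner_algX.
Qed.

(** H is diagonal: it multiplies x^m by m+1. *)
Lemma coef_horner_alg p g m : (horner_alg H p g)`_m = p.[m.+1%:R] * g`_m.
Proof.
elim/poly_ind: p g => [|p c IHp] g.
  by rewrite rmorph0 horner0 mul0r coef0.
rewrite rmorphD rmorphM /= horner_algX horner_algC.
rewrite (_ : I1val c%:A g = c *: g) // coefD coefZ IHp hornerMXaddC mulrDl.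
congr (_ + _).
by rewrite /= coef_deriv coefXM /= -[g`_m *+ _]mulr_natl mulrA.
Qed.

(** The involution turns y (sum_i J^i P_i(H)) = 0 into (sum_i P_i(H) D^i) y^* = 0.  If
g = y^* p had degree m, the coefficient of x^m of (sum_i P_i(H) D^i) g would be that
of g times P_0(m+1), as the terms with i > 0 lower the degree. *)
Lemma lower_left_regular P :
  (forall n, (P`_0).[n.+1%:R] != 0) -> left_regular_set (I1 K) (lower P).
Proof.
move=> P0 y /(congr1 (star charK)); rewrite starM linear0.
rewrite /lower linear_sum /=.
under eq_bigr do rewrite starM star_horner starJexp.
set z := star charK y => sz0.
suff z0 : z = 0 by rewrite -(starK y) -/z z0 linear0.
apply: I1P => p; apply/eqP; apply: contraT => zp0.
have {zp0} : z p != 0 by [].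
rewrite -size_poly_gt0; case zpE: (size (z p)) => [//|m] _.
have zp_m : (z p)`_m != 0.
  have -> : (z p)`_m = lead_coef (z p) by rewrite lead_coefE zpE.
  by rewrite lead_coef_eq0 -size_poly_eq0 zpE.
move: sz0; case sP: (size P) => [|n].
  move/eqP: sP (P0 0%N); rewrite size_poly_eq0 => /eqP->.
  by rewrite coef0 horner0 eqxx.
move/(congr1 (fun b : I1 K => (b p)`_m)).
set S := \sum_(i < n.+1) _.
have -> : (S * z) p = S (z p) by [].
rewrite (_ : (0 : I1 K) p = 0) // coef0.
rewrite I1_sum_fun big_ord_recl coefD coef_sum big1 => [|i _].
  rewrite addr0 mulr1 coef_horner_alg => /eqP.
  by rewrite mulf_eq0 (negPf zp_m) orbF (negPf (P0 m)).
have -> : (horner_alg H P`_(lift ord0 i) * D ^+ lift ord0 i) (z p) =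
          horner_alg H P`_(lift ord0 i) ((D ^+ lift ord0 i) (z p)) by [].
rewrite coef_horner_alg Dexp_fun coef_derivn (@nth_default _ _ (z p)) ?mul0rn ?mulr0 //.
by rewrite zpE lift0 addSn ltnS leq_addl.
Qed.

(** * The set Gamma *)

Lemma left_regularD n : left_regular_set (I1 K) (D ^+ n).
Proof. by move=> y yD; rewrite -[y]mulr1 -(DJexp n) mulrA yD mul0r. Qed.

(** Membership in Gamma is insensitive to F, hence can be tested after multiplying by
a large power of J; and p_0(H) is nonzero as soon as p_0 is, by the nonvanishing of
its eigenvalues p_0(m+1) for m large. *)
Lemma GammaP a : Gamma K a <->
  exists n P, a * J ^+ n = lower P * J ^+ n /\ P`_0 != 0.
Proof.
split=> [[n [p [f [p0 /FidealP[N fN] ->]]]] | [n [P [aP P0]]]].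
  exists N, ((p 0%N)%:P + \poly_(i < n) (if i is 0 then 0 else p i)); split; last first.
    rewrite coefD coefC coef_poly; case: ifP => _; rewrite /= addr0;
      by apply: contraNneq p0 => ->; rewrite rmorph0.
  rewrite mulrDl fN addr0 lowerD lowerC (lowerE (size_poly _ _)).
  congr ((_ + _) * _); rewrite -(big_mkord xpredT (fun i => J ^+ i *
    horner_alg H (\poly_(i < n) (if i is 0 then 0 else p i))`_i)).
  case: n {fN} => [|n]; first by rewrite !big_geq.
  rewrite [RHS]big_ltn // coef_poly /= rmorph0 mulr0 add0r !big_add1 /=.
  by rewrite !big_mkord; apply: eq_bigr => i _; rewrite coef_poly ltnS ltn_ord.
exists (size P), (fun i => P`_i), (a - lower P); split.
- have [N PN] := poly_nonroot_large charK P0.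
  apply: contraTneq (PN N.+1 (leqnSn N)) => hP0.
  have := coef_horner_alg P`_0 'X^N N; rewrite hP0 coefXn eqxx mulr1 => <-.
  by rewrite coef0 eqxx.
- by apply/FidealP; exists n; rewrite mulrBl aP subrr.
- have P_gt0 : (0 < size P)%N.
    by rewrite size_poly_gt0; apply: contraNneq P0 => ->; rewrite coef0.
  suff <- : lower P = horner_alg H P`_0
      + \sum_(1 <= i < size P) J ^+ i * horner_alg H P`_i by rewrite addrC subrK.
  rewrite /lower -(big_mkord xpredT (fun i => J ^+ i * horner_alg H P`_i)).
  by rewrite big_ltn // mul1r.
Qed.

(** Taking n beyond all natural roots of p_0 makes all values p_0(m+1+n) nonzero, so
that [lower_left_regular] applies to D^n a J^n. *)
Lemma Gamma_left_regular a : Gamma K a ->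
  exists n, left_regular_set (I1 K) (D ^+ n * a).
Proof.
case/GammaP=> n [P [aP P0]].
have [M PM] := poly_nonroot_large charK P0.
pose N := maxn n M.
have aN : a * J ^+ N = J ^+ N * lower (shift N P).
  by rewrite -lowerJ -(subnKC (leq_maxl n M : (n <= N)%N)) exprD !mulrA aP.
exists N => y yDa.
have: left_regular_set (I1 K) (lower (shift N P)).
  apply: lower_left_regular => m; rewrite coef_map /= horner_comp hornerD hornerX.
  rewrite -polyC_natr hornerC -natrD PM //.
  by rewrite (leq_trans (leq_maxr n M)) // leq_addl.
apply; rewrite -[lower _]mul1r -(DJexp N) -(mulrA (D ^+ N)) -aN.
by rewrite !mulrA -(mulrA y) yDa mul0r.
Qed.

Lemma ldegP a : Gamma K a -> left_regular_set (I1 K) (D ^+ ldeg a * a) /\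
  forall j, left_regular_set (I1 K) (D ^+ j * a) -> (ldeg a <= j)%N.
Proof.
move=> /Gamma_left_regular[n regn]; rewrite /ldeg.
pose m := ex_minn (ex_intro (fun i => `[< left_regular_set (I1 K) (D ^+ i * a) >])
  n (asboolT regn)).
set S := (X in xget _ X); apply: (@xgetPex _ 0%N S); exists m.
rewrite /m; case: ex_minnP => i /asboolP regi mini.
by split=> // j regj; apply: mini; exact/asboolP.
Qed.

(** After factoring the lowest power of J out of r J^n, the obstruction
[not_left_regular] bounds that power by n, and J^(n-k) r is then in Gamma. *)
Lemma left_regular_Gamma r : left_regular_set (I1 K) r ->
  exists n a, Gamma K a /\ r = D ^+ n * a.
Proof.
move=> reg_r; have [n [P rP]] := I1_eventually_lower r.
have [P0|/poly_factorXn[k [Q [PE Q0]]]] := eqVneq P 0.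
  by case: (@not_left_regular r n 0); rewrite // rP P0 lower0 mulr0.
rewrite {P}PE lowerXn in rP; have [nk|kn] := ltnP n k.
  case: (@not_left_regular r n (J ^+ (k - n.+1) * lower Q)) => //.
  by rewrite rP mulrA -exprD subnKC.
exists (n - k)%N, (J ^+ (n - k) * r); split; last by rewrite mulrA DJexp mul1r.
apply/GammaP; exists n, (unshift n Q).
rewrite lowerJ unshiftK -mulrA rP mulrA -exprD subnK //; split=> //.
by rewrite coef_map /= comp_poly2_eq0 // -polyC_natr size_XsubC.
Qed.

End IntegroDifferential.

(** * Characterization of the regular elements *)

Local Open Scope classical_set_scope.

Theorem theorem6p7 (K : fieldType) (charK : [pchar K] =i pred0) :
  left_regular_set (I1 K) =
    [set I1d K ^+ (ldeg a + i) * a | i in [set: nat] & a in Gamma K] /\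
  right_regular_set (I1 K) = star charK @` left_regular_set (I1 K).
Proof.
split; apply/seteqP; split=> [r reg_r|r].
- have [n [a [Ga rE]]] := left_regular_Gamma charK reg_r.
  have [_ mina] := ldegP charK Ga; rewrite {}rE in reg_r *.
  exists (n - ldeg a)%N => //; exists a => //=.
  by rewrite subnKC // mina.
- case=> i _ [a Ga <-]; rewrite addnC exprD -mulrA.
  by apply: left_regular_mul; [exact: left_regularD|case: (ldegP charK Ga)].
- exists (star charK r); last exact: starK.
  move=> y /(congr1 (star charK)); rewrite starM starK linear0 => /reg_r sy0.
  by rewrite -(starK charK y) sy0 linear0.
- case=> a reg_a <- y /(congr1 (star charK)); rewrite starM starK linear0.
  by move/reg_a => sy0; rewrite -(starK charK y) sy0 linear0.
Qed.
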